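(* Let $X$ be a Boolean space with Cantor-Bendixson rank $\alpha$. Then $C^-(X,\mathbb{Z})_\infty^+$ has m-dimension $\alpha$.
   Context: A space is Boolean if it is Hausdorff, compact and totally disconnected. $C(X,\mathbb{Z})$ is the lattice ordered abelian group ($\ell$-group) of continuous functions $X\to\mathbb{Z}$ ($\mathbb{Z}$ discrete) with pointwise operations and order. For $X$ of CB rank $\alpha$ (an ordinal), $C^-(X,\mathbb{Z})$ is the $\ell$-subgroup of those $f\in C(X,\mathbb{Z})$ with $f(x)=0$ for all $x\in X^{(\alpha)}$. For an $\ell$-group $\Gamma$, $\Gamma^+$ is its positive cone and $\Gamma_\infty^+=\Gamma^+\cup\{\infty\}$ with $\infty$ a new top element. Cantor-Bendixson: $X^{(0)}=X$, $X^{(\alpha+1)}$ is the set of non-isolated points of $X^{(\alpha)}$, $X^{(\lambda)}=\bigcap_{\alpha<\lambda}X^{(\alpha)}$ for limit $\lambda$; the CB rank of a non-empty space $X$ is the supremum of all $\alpha$ with $X^{(\alpha)}\neq\emptyset$ if it exists and $\infty$ otherwise. m-dimension: for a bounded modular lattice $L$, let $\sim$ be the smallest congruence identifying the endpoints of every interval with at most two elements. Put $L_0=L$, $L_{\alpha+1}=L_\alpha/\!\sim$, and for limit $\lambda$ let $L_\lambda$ be the quotient of $L$ by the union of the kernels of $L\to L_\alpha$, $\alpha<\lambda$. If $L$ has at least two elements and some $L_\alpha$ is a one-point lattice, then the least such $\alpha$ is a successor and the m-dimension of $L$ is $\alpha-1$; otherwise $L$ does not have m-dimension. *)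

(* Defs.v *)
From HB Require Import structures.
From mathcomp Require Import all_boot all_order all_algebra.
From mathcomp Require Import all_classical.
From mathcomp Require Import topology.

Set Implicit Arguments.
Unset Strict Implicit.
Unset Printing Implicit Defensive.

Import Order.TTheory GRing.Theory.

Local Open Scope classical_set_scope.
Local Open Scope order_scope.

(* Every ordinal is zero, a successor, or the supremum of a nonempty family
   (every limit is the supremum of the smaller ordinals).  Distinct trees may
   denote the same ordinal: equality of ordinals is [a <=o b /\ b <=o a]. *)
Inductive Ord : Type :=
| OZero
| OSucc (a : Ord)
| OSup (I : Type) (i0 : I) (f : I -> Ord).

Reserved Notation "a <=o b" (at level 70, no associativity).
Reserved Notation "a <o b" (at level 70, no associativity).

Inductive ord_le : Ord -> Ord -> Prop :=
| ord_le_zero b : OZero <=o b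
| ord_le_succ a b : a <o b -> OSucc a <=o b
| ord_le_sup I i0 (f : I -> Ord) b :
    (forall i, f i <=o b) -> OSup i0 f <=o b
with ord_lt : Ord -> Ord -> Prop :=
| ord_lt_succ a b : a <=o b -> a <o OSucc b
| ord_lt_sup a I i0 (f : I -> Ord) i : a <o f i -> a <o OSup i0 f
where "a <=o b" := (ord_le a b) and "a <o b" := (ord_lt a b).

Scheme ord_le_lt_ind := Minimality for ord_le Sort Prop
with ord_lt_le_ind := Minimality for ord_lt Sort Prop.
Combined Scheme ord_mut_ind from ord_le_lt_ind, ord_lt_le_ind.

Lemma ord_le_or_gt a b : a <=o b \/ b <o a.
Proof.
have dual x : (forall b, x <=o b \/ b <o x) -> forall b, x <o b \/ b <=o x.
  move=> xP; elim=> [|y _|I i0 f IH]; first by right; constructor.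
    by have [?|?] := xP y; [left|right]; constructor.
  have [[i xfi]|nxf] := pselect (exists i, x <o f i).
    by left; apply: ord_lt_sup xfi.
  by right; constructor => i; have [xfi|//] := IH i; case: nxf; exists i.
elim: a b => [|a IH|I i0 f IH] b; first by left; constructor.
  by have [?|?] := dual _ IH b; [left|right]; constructor.
have [?|/existsNP[i nfib]] := pselect (forall i, f i <=o b).
  by left; constructor.
by right; have [//|bfi] := IH i b; apply: ord_lt_sup bfi.
Qed.

Section CantorBendixson.
Variable X : topologicalType.

(* The derivatives decrease, so the last clause is the usual one at limits and
   is harmless for a family with a largest member. *)
Fixpoint cb_derivative (a : Ord) : set X :=
  match a with
  | OZero => [set: X]
  | OSucc b => cb_derivative b `\` isolated (cb_derivative b)
  | OSup _ _ f => \bigcap_i cb_derivative (f i)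
  end.

(* [a] is the supremum of the ordinals [b] with nonempty [b]-th derivative. *)
Definition has_cb_rank (a : Ord) : Prop :=
  [/\ [set: X] !=set0,
      forall b, cb_derivative b !=set0 -> b <=o a
    & forall c, (forall b, cb_derivative b !=set0 -> b <=o c) -> a <=o c].

Definition boolean_space : Prop :=
  [/\ hausdorff_space X, compact [set: X] & totally_disconnected [set: X]].

End CantorBendixson.

Arguments cb_derivative : clear implicits.
Arguments has_cb_rank : clear implicits.
Arguments boolean_space : clear implicits.

(* [None] is the new top element. *)
Definition with_top (T : Type) : Type := option T.

Section WithTop.
Context {d : Order.disp_t} {T : distrLatticeType d}.

HB.instance Definition _ := Choice.copy (with_top T) (option T).

Implicit Types x y z : with_top T.

Definition wt_le x y : bool :=
  match x, y with
  | Some u, Some v => u <= v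
  | _, None => true
  | None, Some _ => false
  end.

Definition wt_meet x y : with_top T :=
  match x, y with
  | Some u, Some v => Some (u `&` v)
  | Some _, None => x
  | None, _ => y
  end.

Definition wt_join x y : with_top T :=
  match x, y with
  | Some u, Some v => Some (u `|` v)
  | _, _ => None
  end.

Lemma wt_le_refl : reflexive wt_le.
Proof. by case=> /=. Qed.

Lemma wt_le_anti : antisymmetric wt_le.
Proof. by move=> [u|] [v|] //= /le_anti->. Qed.

Lemma wt_le_trans : transitive wt_le.
Proof. by move=> [v|] [u|] [w|] //=; apply: le_trans. Qed.

HB.instance Definition _ :=
  Order.Le_isPOrder.Build d (with_top T) wt_le_refl wt_le_anti wt_le_trans.

Lemma wt_lexI x y z : (x <= wt_meet y z) = (x <= y) && (x <= z).
Proof.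
case: x y z => [u|] [v|] [w|] //=; rewrite /Order.le /= ?andbT //.
exact: lexI.
Qed.

Lemma wt_leUx x y z : (wt_join x y <= z) = (x <= z) && (y <= z).
Proof.
case: x y z => [u|] [v|] [w|] //=; rewrite /Order.le /= ?andbF //.
exact: leUx.
Qed.

HB.instance Definition _ :=
  Order.POrder_MeetJoin_isLattice.Build d (with_top T) wt_lexI wt_leUx.

Lemma wt_meetUl : @left_distributive (with_top T) _ Order.meet Order.join.
Proof.
move=> [u|] [v|] [w|]; rewrite /Order.meet /Order.join //=; congr Some.
- exact: meetUl.
- by rewrite joinC meetC meetKU.
- by rewrite meetC meetKU.
- by rewrite joinxx.
Qed.

HB.instance Definition _ :=
  Order.Lattice_Meet_isDistrLattice.Build d (with_top T) wt_meetUl.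

Lemma wt_lex1 x : x <= None :> with_top T.
Proof. by case: x. Qed.

HB.instance Definition _ := Order.hasTop.Build d (with_top T) wt_lex1.

End WithTop.

Section WithTopBottom.
Context {d : Order.disp_t} {T : bDistrLatticeType d}.

Lemma wt_le0x (x : with_top T) : Some \bot <= x :> with_top T.
Proof. by case: x => //= u; exact: (le0x u). Qed.

HB.instance Definition _ := Order.hasBottom.Build d (with_top T) wt_le0x.

End WithTopBottom.


Section Cminus.
Variables (X : topologicalType) (a : Ord).

Definition is_Cminus : {pred X -> int} :=
  [pred f : X -> int | `[< continuous (f : X -> discrete_topology int) /\
                          (forall x, cb_derivative X a x -> f x = 0%R) >]].

Lemma discrete_continuousP (f : X -> int) :
  continuous (f : X -> discrete_topology int) <->
  forall x, \forall y \near x, f y = f x.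
Proof.
split=> [fc x|fc x]; last first.
  by apply/discrete_cvg; exact: fc.
by move/discrete_cvg: (fc x).
Qed.

Lemma is_CminusP (f : X -> int) : reflect
  ((forall x, \forall y \near x, f y = f x) /\
   (forall x, cb_derivative X a x -> f x = 0%R)) (f \in is_Cminus).
Proof.
by apply: (iffP (asboolP _)) => -[fc f0]; split=> //; apply/discrete_continuousP.
Qed.

Lemma is_Cminus_zmod_closed : zmod_closed is_Cminus.
Proof.
split=> [|f g /is_CminusP[fc f0] /is_CminusP[gc g0]]; apply/is_CminusP; split.
- by move=> x; apply: nearW.
- by [].
- move=> x; apply: filterS2 (fc x) (gc x) => y fy gy.
  by rewrite !fctE fy gy.
- by move=> x xa; rewrite !fctE f0// g0// subr0.
Qed.

Lemma is_Cminus_meet_closed : meet_closed is_Cminus.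
Proof.
move=> f g /is_CminusP[fc f0] /is_CminusP[gc g0]; apply/is_CminusP; split.
- move=> x; apply: filterS2 (fc x) (gc x) => y fy gy.
  by rewrite !meetfE fy gy.
- by move=> x xa; rewrite meetfE f0// g0// meetxx.
Qed.

Lemma is_Cminus_join_closed : join_closed is_Cminus.
Proof.
move=> f g /is_CminusP[fc f0] /is_CminusP[gc g0]; apply/is_CminusP; split.
- move=> x; apply: filterS2 (fc x) (gc x) => y fy gy.
  by rewrite !joinfE fy gy.
- by move=> x xa; rewrite joinfE f0// g0// joinxx.
Qed.

HB.instance Definition _ :=
  GRing.isZmodClosed.Build _ is_Cminus is_Cminus_zmod_closed.

(* The l-group C^-(X, Z): pointwise operations inherited from [X -> int]. *)
Record Cminus := MkCminus {
  Cminus_fun :> X -> int;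
  Cminus_funP : Cminus_fun \in is_Cminus
}.

HB.instance Definition _ := [isSub for Cminus_fun].
HB.instance Definition _ := [Choice of Cminus by <:].
HB.instance Definition _ := [SubChoice_isSubZmodule of Cminus by <:].
HB.instance Definition _ :=
  Order.SubChoice_isSubLattice.Build _ _ _ FunOrder.fun_display Cminus
    is_Cminus_meet_closed is_Cminus_join_closed.

Lemma Cminus_meetUl : @left_distributive Cminus _ Order.meet Order.join.
Proof.
move=> f g h; apply: val_inj; apply/funext => x.
exact: meetUl.
Qed.

HB.instance Definition _ :=
  Order.Lattice_Meet_isDistrLattice.Build _ Cminus Cminus_meetUl.


Definition is_pos : {pred Cminus} := [pred f | (0%R : Cminus) <= f].

Lemma is_pos_meet_closed : meet_closed is_pos.
Proof. by move=> f g f0 g0; rewrite -topredE /is_pos /= lexI; apply/andP. Qed.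

Lemma is_pos_join_closed : join_closed is_pos.
Proof. by move=> f g f0 _; rewrite -topredE /is_pos /= lexU2// (f0 : _ <= _). Qed.

Record Cminus_pos := MkCminus_pos {
  Cminus_pos_fun :> Cminus;
  Cminus_pos_funP : Cminus_pos_fun \in is_pos
}.

HB.instance Definition _ := [isSub for Cminus_pos_fun].
HB.instance Definition _ := [Choice of Cminus_pos by <:].
HB.instance Definition _ :=
  Order.SubChoice_isSubLattice.Build _ _ _ FunOrder.fun_display Cminus_pos
    is_pos_meet_closed is_pos_join_closed.

Lemma Cminus_pos_meetUl :
  @left_distributive Cminus_pos _ Order.meet Order.join.
Proof. by move=> f g h; apply: val_inj; exact: meetUl. Qed.

HB.instance Definition _ :=
  Order.Lattice_Meet_isDistrLattice.Build _ Cminus_pos Cminus_pos_meetUl.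

Lemma Cminus_zero_pos : (0%R : Cminus) \in is_pos.
Proof. exact: lexx. Qed.

Lemma Cminus_pos_le0x (f : Cminus_pos) : MkCminus_pos Cminus_zero_pos <= f.
Proof. exact: (Cminus_pos_funP f). Qed.

HB.instance Definition _ := Order.hasBottom.Build _ Cminus_pos Cminus_pos_le0x.

Definition Cminus_pos_infty : tbDistrLatticeType FunOrder.fun_display :=
  with_top Cminus_pos.

End Cminus.

Section Congruence.
Context {d : Order.disp_t} {L : latticeType d}.
Implicit Types (r t : L -> L -> Prop).

Definition congruence t : Prop :=
  [/\ forall x, t x x,
      forall x y, t x y -> t y x,
      forall x y z, t x y -> t y z -> t x z,
      forall x x' y y', t x x' -> t y y' -> t (x `&` y) (x' `&` y')
    & forall x x' y y', t x x' -> t y y' -> t (x `|` y) (x' `|` y')].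

Definition generated_congruence r : L -> L -> Prop := fun x y =>
  forall t, congruence t -> (forall u v, r u v -> t u v) -> t x y.

Lemma generated_congruenceP r : congruence (generated_congruence r).
Proof.
split=> [x|x y xy|x y z xy yz|x x' y y' xx yy|x x' y y' xx yy] t tP rt;
  case: (tP) => tR tC tT tI tU.
- exact: tR.
- exact: tC (xy t tP rt).
- exact: tT (xy t tP rt) (yz t tP rt).
- exact: tI (xx t tP rt) (yy t tP rt).
- exact: tU (xx t tP rt) (yy t tP rt).
Qed.

Lemma sub_generated_congruence r x y : r x y -> generated_congruence r x y.
Proof. by move=> rxy t _; apply. Qed.

Lemma generated_congruence_id t x y :
  congruence t -> generated_congruence t x y <-> t x y.
Proof.
by move=> tP; split=> [g|]; [exact: (g t)|exact: sub_generated_congruence].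
Qed.

Definition generated_congruenceb r : rel L :=
  fun x y => `[< generated_congruence r x y >].

Lemma generated_congruenceb_equiv r : equiv_class_of (generated_congruenceb r).
Proof.
have [tR tC tT _ _] := generated_congruenceP r.
split=> [x|x y|y x z].
- exact/asboolP.
- by apply/asboolP/asboolP; apply: tC.
- by move=> /asboolP xy /asboolP yz; apply/asboolP; apply: tT yz.
Qed.

Canonical generated_congruence_equiv r :=
  EquivRelPack (generated_congruenceb_equiv r).

End Congruence.

Section LatticeQuotient.
Context {d : Order.disp_t} {L : tbLatticeType d} (r : L -> L -> Prop).

Local Open Scope quotient_scope.

(* L modulo the smallest congruence containing r *)
Definition lattice_quot : Type := {eq_quot generated_congruence_equiv r}.

HB.instance Definition _ := Choice.on lattice_quot.
HB.instance Definition _ := EqQuotient.on lattice_quot.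

Definition lq_pi : L -> lattice_quot := \pi_lattice_quot.

Lemma lq_piE x y : lq_pi x = lq_pi y <-> generated_congruence r x y.
Proof.
by split=> [/eqmodP/asboolP|xy]; [|apply/eqmodP/asboolP].
Qed.

Lemma lq_reprK (q : lattice_quot) : lq_pi (repr q) = q.
Proof. exact: reprK. Qed.

Definition lq_meet (p q : lattice_quot) := lq_pi (repr p `&` repr q).
Definition lq_join (p q : lattice_quot) := lq_pi (repr p `|` repr q).
Definition lq_le (p q : lattice_quot) := lq_meet p q == p.

Lemma lq_piI x y : lq_pi (x `&` y) = lq_meet (lq_pi x) (lq_pi y).
Proof.
have [_ _ _ tI _] := generated_congruenceP r.
by apply/lq_piE; apply: tI; apply/lq_piE; rewrite lq_reprK.
Qed.

Lemma lq_piU x y : lq_pi (x `|` y) = lq_join (lq_pi x) (lq_pi y).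
Proof.
have [_ _ _ _ tU] := generated_congruenceP r.
by apply/lq_piE; apply: tU; apply/lq_piE; rewrite lq_reprK.
Qed.

Lemma lq_ind (P : lattice_quot -> Prop) : (forall x, P (lq_pi x)) -> forall q, P q.
Proof. by move=> Ppi q; rewrite -[q]lq_reprK. Qed.

Lemma lq_meetC : commutative lq_meet.
Proof. by elim/lq_ind=> x; elim/lq_ind=> y; rewrite -!lq_piI meetC. Qed.

Lemma lq_joinC : commutative lq_join.
Proof. by elim/lq_ind=> x; elim/lq_ind=> y; rewrite -!lq_piU joinC. Qed.

Lemma lq_meetA : associative lq_meet.
Proof.
by elim/lq_ind=> x; elim/lq_ind=> y; elim/lq_ind=> z; rewrite -!lq_piI meetA.
Qed.

Lemma lq_joinA : associative lq_join.
Proof.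
by elim/lq_ind=> x; elim/lq_ind=> y; elim/lq_ind=> z; rewrite -!lq_piU joinA.
Qed.

Lemma lq_joinKI q p : lq_meet p (lq_join p q) = p.
Proof.
by elim/lq_ind: q => y; elim/lq_ind: p => x; rewrite -lq_piU -lq_piI joinKI.
Qed.

Lemma lq_meetKU q p : lq_join p (lq_meet p q) = p.
Proof.
by elim/lq_ind: q => y; elim/lq_ind: p => x; rewrite -lq_piI -lq_piU meetKU.
Qed.

Lemma lq_le_refl : reflexive lq_le.
Proof. by elim/lq_ind=> x; rewrite /lq_le -lq_piI meetxx. Qed.

Lemma lq_le_anti : antisymmetric lq_le.
Proof. by move=> p q /andP[/eqP pq /eqP qp]; rewrite -pq lq_meetC qp. Qed.

Lemma lq_le_trans : transitive lq_le.
Proof.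
by move=> q p s /eqP pq /eqP qs; rewrite /lq_le -pq -lq_meetA qs.
Qed.

HB.instance Definition _ :=
  Order.Le_isPOrder.Build d lattice_quot lq_le_refl lq_le_anti lq_le_trans.
HB.instance Definition _ :=
  Order.POrder_isLattice.Build d lattice_quot lq_meetC lq_joinC lq_meetA
    lq_joinA lq_joinKI lq_meetKU (fun _ _ => erefl).

Lemma lq_le0x (q : lattice_quot) : lq_pi \bot <= q.
Proof. by elim/lq_ind: q => x; rewrite /Order.le /= /lq_le -lq_piI meet0x. Qed.

Lemma lq_lex1 (q : lattice_quot) : q <= lq_pi \top.
Proof. by elim/lq_ind: q => x; rewrite /Order.le /= /lq_le -lq_piI meetx1. Qed.

HB.instance Definition _ := Order.hasBottom.Build d lattice_quot lq_le0x.
HB.instance Definition _ := Order.hasTop.Build d lattice_quot lq_lex1.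

End LatticeQuotient.

Section MDimension.
Context {d : Order.disp_t}.

Definition small_interval (L : latticeType d) (x y : L) : Prop :=
  x <= y /\ ([set z | x <= z <= y] #<= `I_2)%card.

Variable L : tbLatticeType d.

Record quotient_of : Type := QuotientOf {
  quotient_lattice :> tbLatticeType d;
  quotient_map : L -> quotient_lattice
}.

(* The lattices L_a with their maps L -> L_a.  At a supremum, L is divided by
   the union of the kernels of the L -> L_(f i), which is already a congruence
   (see [mdim_kernel_sup]).  Nothing here depends on L being modular. *)
Fixpoint mdim_quot (a : Ord) : quotient_of :=
  match a with
  | OZero => @QuotientOf L id
  | OSucc b =>
      let M := mdim_quot b in
      @QuotientOf (lattice_quot (@small_interval M))
        (fun x => lq_pi _ (quotient_map M x))
  | OSup _ _ f =>
      let r x y := exists i,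
        quotient_map (mdim_quot (f i)) x = quotient_map (mdim_quot (f i)) y in
      @QuotientOf (lattice_quot r) (lq_pi r)
  end.

Definition mdim_kernel (a : Ord) (x y : L) : Prop :=
  quotient_map (mdim_quot a) x = quotient_map (mdim_quot a) y.

Lemma mdim_quotP a :
  [/\ forall q, exists x, quotient_map (mdim_quot a) x = q,
      {morph quotient_map (mdim_quot a) : x y / x `&` y}
    & {morph quotient_map (mdim_quot a) : x y / x `|` y}].
Proof.
elim: a => [|a [aS aI aU]|I i0 f _] /=.
- by split=> // q; exists q.
- split=> [|x y|x y]; last 2 first.
  + by rewrite aI; exact: lq_piI.
  + by rewrite aU; exact: lq_piU.
  by move=> q; have [x xE] := aS (repr q); exists x; rewrite xE; exact: lq_reprK.
- split=> [|x y|x y]; last 2 first.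
  + exact: lq_piI.
  + exact: lq_piU.
  by move=> q; exists (repr q); exact: lq_reprK.
Qed.

Lemma mdim_kernel_congruence a : congruence (mdim_kernel a).
Proof.
have [_ aI aU] := mdim_quotP a; rewrite /mdim_kernel.
split=> // [x y z -> //|x x' y y' xx yy|x x' y y' xx yy].
  by rewrite !aI xx yy.
by rewrite !aU xx yy.
Qed.

Lemma mdim_kernel_succ_mono a b :
  (forall x y, mdim_kernel a x y -> mdim_kernel b x y) ->
  forall x y, mdim_kernel (OSucc a) x y -> mdim_kernel (OSucc b) x y.
Proof.
move=> ab x y /lq_piE; set g := generated_congruence _ => gxy; apply/lq_piE.
have [aS aI aU] := mdim_quotP a; have [bS bI bU] := mdim_quotP b.
pose pa := quotient_map (mdim_quot a); pose pb := quotient_map (mdim_quot b).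
set h := generated_congruence _.
have [hR hC hT hI hU] : congruence h := generated_congruenceP _.
have abE u v : pa u = pa v -> pb u = pb v by exact: ab.
pose t p q := forall u v, pa u = p -> pa v = q -> h (pb u) (pb v).
suff : t (pa x) (pa y) by apply.
apply: gxy => [|p q [pq pq2] u v up vq].
  split.
  - by move=> p u v up vp; rewrite (abE u v) ?up.
  - by move=> p q pq u v up vq; apply: hC; exact: pq.
  - move=> p q s pq qs u v up vs; have [w wq] := aS q.
    by apply: hT (pq _ _ up wq) (qs _ _ wq vs).
  - move=> p p' q q' pp qq u v uE vE.
    have [[x1 x1E] [x2 x2E]] := (aS p, aS p'); have [[y1 y1E] [y2 y2E]] := (aS q, aS q').
    rewrite (abE u (x1 `&` y1)) ?(abE v (x2 `&` y2)) /pa ?aI ?x1E ?y1E ?x2E ?y2E//.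
    by rewrite /pb !bI; apply: hI; [exact: pp|exact: qq].
  - move=> p p' q q' pp qq u v uE vE.
    have [[x1 x1E] [x2 x2E]] := (aS p, aS p'); have [[y1 y1E] [y2 y2E]] := (aS q, aS q').
    rewrite (abE u (x1 `|` y1)) ?(abE v (x2 `|` y2)) /pa ?aU ?x1E ?y1E ?x2E ?y2E//.
    by rewrite /pb !bU; apply: hU; [exact: pp|exact: qq].
apply: sub_generated_congruence.
have uv : pb u <= pb v.
  rewrite leEmeet -bI; apply/eqP/abE.
  by rewrite /pa aI -!/pa up vq; apply/meet_idPl.
split=> //.
have [f fE] := choice aS.
apply: card_le_trans pq2; apply: card_le_trans (card_image_le (pb \o f) _).
apply: subset_card_le => s /andP[us sv]; have [w ws] := bS s.
have pqw : p <= (pa w `|` p) `&` q <= q by rewrite lexI leUr pq leIr.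
exists ((pa w `|` p) `&` q) => //=.
transitivity (pb ((w `|` u) `&` v)).
  by apply: abE; rewrite /pa fE aI aU -!/pa up vq.
by rewrite /pb bI bU ws -!/pb (join_l us) (meet_l sv).
Qed.

Lemma mdim_kernel_mono :
  (forall a b, a <=o b -> forall x y, mdim_kernel a x y -> mdim_kernel b x y) /\
  (forall a b, a <o b ->
     forall x y, mdim_kernel (OSucc a) x y -> mdim_kernel b x y).
Proof.
apply: ord_mut_ind => [b x y xy|//|I i0 f b _ IH x y|a b _|a I i0 f i _ IH x y xy].
- by congr (quotient_map _ _); exact: xy.
- move=> /lq_piE; apply; first exact: mdim_kernel_congruence.
  by move=> u v [i]; exact: IH.
- exact: mdim_kernel_succ_mono.
- by apply/lq_piE; apply: sub_generated_congruence; exists i; exact: IH.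
Qed.

Lemma mdim_kernel_sup I (i0 : I) (f : I -> Ord) x y :
  mdim_kernel (OSup i0 f) x y <-> exists i, mdim_kernel (f i) x y.
Proof.
have [le_mono lt_mono] := mdim_kernel_mono.
split=> [/lq_piE xy|[i xy]]; last first.
  by apply/lq_piE; apply: sub_generated_congruence; exists i.
have dir i j : exists k, forall u v,
    mdim_kernel (f i) u v \/ mdim_kernel (f j) u v -> mdim_kernel (f k) u v.
  have [ij|ji] := ord_le_or_gt (f i) (f j).
    by exists j => u v [|//]; exact: le_mono.
  by exists i => u v [//|uv]; apply: lt_mono ji _ _ _; congr (lq_pi _ _).
apply: (xy (fun u v => exists i, mdim_kernel (f i) u v)) => //; split.
- by move=> u; exists i0.
- by move=> u v [i uv]; exists i.
- move=> u v w [i uv] [j vw]; have [k kP] := dir i j; exists k.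
  by have [_ _ kT _ _] := mdim_kernel_congruence (f k);
     apply: (kT _ v); apply: kP; [left|right].
- move=> u u' v v' [i uu] [j vv]; have [k kP] := dir i j; exists k.
  by have [_ _ _ kI _] := mdim_kernel_congruence (f k);
     apply: kI; apply: kP; [left|right].
- move=> u u' v v' [i uu] [j vv]; have [k kP] := dir i j; exists k.
  by have [_ _ _ _ kU] := mdim_kernel_congruence (f k);
     apply: kU; apply: kP; [left|right].
Qed.

Definition trivial_quot (a : Ord) : Prop :=
  forall p q : mdim_quot a, p = q.

(* The least ordinal with a one-point quotient is the successor of [a]. *)
Definition has_mdim (a : Ord) : Prop :=
  [/\ exists x y : L, x <> y,
      trivial_quot (OSucc a)
    & forall b, trivial_quot b -> OSucc a <=o b].

End MDimension.

(* Main.v *)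
Require Import Defs.
From mathcomp Require Import all_boot all_order all_algebra.
From mathcomp Require Import all_classical topology.

Set Implicit Arguments.
Unset Strict Implicit.
Unset Printing Implicit Defensive.

Import Order.TTheory GRing.Theory Num.Theory.

Local Open Scope order_scope.
Local Open Scope classical_set_scope.

(** Write [X^(b)] for the [b]-th Cantor-Bendixson derivative and [L] for the
    lattice of nonnegative functions of [C^-(X, Z)] with a top element added.
    The whole proof is the identification of the iterated quotients of [L]: for
    [b <= a], two functions have the same image in [L_b] exactly when they agree
    on [X^(b)], and the top element stays alone in its class
    ([mdim_kernelE]).  In other words [L_b] is the lattice of nonnegative
    functions on [X^(b)] vanishing on [X^(a)], with a top element.

    Granting this, [L_a] has two elements, the class of the functions and the
    top, so that [L_(a+1)] is a point; and no [L_b] with [b <= a] is a point,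
    since its top and bottom differ.

    The identification goes by induction on [b].  At a successor, let
    [f] and [g] agree on [X^(b+1)].  Locally on [X] one can pass from [f] to [g]
    inside one class of [L_(b+1)]: near a point outside [X^(b)] nothing changes
    in [L_b], near a point of [X^(b+1)] nothing changes at all, and near an
    isolated point of [X^(b)] one climbs by finitely many steps of height one
    at a single point of [X^(b)], each of which is a two-element interval of
    [L_b] ([isolated_kernel_succ]).  Compactness glues these local changes
    ([agree_kernel_succ]).  Conversely, a two-element interval of [L_b] cannot
    contain functions that differ at a point of [X^(b+1)]: such a point is a
    limit of [X^(b)], so a clopen set can separate it from a nearby point of
    [X^(b)], and changing the function only on that clopen set produces a third
    element.  Nor can it join a function [f] to the top, because adding one to
    [f] near a point of [X^(b)] outside [X^(a)] gives an element in between
    ([adjacent_agree]); such a point exists because [b] is below the rank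
    ([cb_strict_below_rank]).  At a supremum, two functions that agree on the
    intersection of a decreasing family of derivatives agree on one of its
    members, again by compactness ([agree_sup]).

    The clopen sets come from [boolean_zero_dimensional]: in a compact Hausdorff
    space, being totally disconnected forces the clopen sets to separate
    points. *)

(** * Ordinals *)

Lemma ord_le_view a b : a <=o b ->
  match a with
  | OZero => True
  | OSucc c => c <o b
  | OSup _ _ f => forall i, f i <=o b
  end.
Proof. by case. Qed.

Lemma ord_lt_view a b : a <o b ->
  match b with
  | OZero => False
  | OSucc c => a <=o c
  | OSup _ _ f => exists i, a <o f i
  end.
Proof. by case=> // c I i0 f i cfi; exists i. Qed.

Lemma ord_le_bound a I i0 (f : I -> Ord) i : a <=o f i -> a <=o OSup i0 f.
Proof.
elim: a => [|a _|J j0 g IH] /ord_le_view afi; first by constructor.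
  by constructor; apply: ord_lt_sup afi.
by constructor=> j; apply: IH.
Qed.

Lemma ord_le_refl a : a <=o a.
Proof.
elim: a => [|a IH|I i0 f IH]; first by constructor.
  by do 2!constructor.
by constructor=> i; exact: ord_le_bound (IH i).
Qed.

Lemma ord_ltW a b : a <o b -> a <=o b.
Proof.
elim: b a => [|b ltb|I i0 f IH] a /ord_lt_view //; last first.
  by move=> [i /IH]; exact: ord_le_bound.
elim: a => [|a _|I i0 f IH] /ord_le_view afb; first by constructor.
  by do 2!constructor; apply: ltb.
by constructor=> i; apply: IH.
Qed.

Lemma ord_le_lt_asym a b : a <=o b -> ~ b <o a.
Proof.
elim: a b => [|a IH|I i0 f IH] b /ord_le_view.
- by move=> _ /ord_lt_view.
- move=> + /ord_lt_view; elim: b => [|b _|I i0 f IHf] /ord_lt_view //.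
    by move=> ab /ord_le_view; exact: IH.
  by move=> [i afi] /ord_le_view/(_ i); exact: IHf.
- by move=> fb /ord_lt_view[i]; exact: IH.
Qed.

(** * Boolean spaces *)

(** Compactness as an induction principle: a property of sets that holds
    locally and passes to finite unions holds globally.  It replaces the choice
    of a finite subcover. *)
Lemma compact_ind (X : topologicalType) (P : set X -> Prop) :
    compact [set: X] -> P set0 ->
    (forall U V, P U -> P V -> P (U `|` V)) ->
    (forall x : X, exists2 U : set X, nbhs x U & P U) ->
  P [set: X].
Proof.
move=> /compact_near_coveringP cX P0 PU Ploc.
(* The filter generated by the sets of supersets of the members of [P]. *)
pose F := filter_from P (fun U => [set W | U `<=` W]).
have FF : Filter F.
  apply: filter_from_filter; first by exists set0.
  move=> U V pU pV; exists (U `|` V); first exact: PU.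
  move=> W /= UVW.
  by split; apply: subset_trans UVW; [exact: subsetUl|exact: subsetUr].
have [x _|V pV /(_ V (@subset_refl _ V)) VT] := cX _ F (fun W x => W x) FF.
  have [U xU pU] := Ploc x; exists (U, [set W | U `<=` W]).
    by split=> //; exists U.
  by move=> [y W] /= [Uy]; exact.
by rewrite (_ : setT = V)//; apply/seteqP; split.
Qed.

(** The intersection [Q] of the clopen sets around a point is connected: if a
    closed subset [B] of [Q] and its relative complement were separated by open
    sets, then by compactness so would be a clopen set containing [Q], whose
    clopen trace on one side contains the point and hence all of [Q].  In a
    totally disconnected space [Q] is therefore a single point. *)
Lemma boolean_zero_dimensional (X : topologicalType) :
  boolean_space X -> zero_dimensional X.
Proof.
move=> [hX cX tX] x y xy; apply: contrapT => nsep.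
pose Q := \bigcap_(C in [set C : set X | clopen C /\ C x]) C.
have Qx : Q x by move=> C [].
have Qy : Q y.
  by move=> C [cC Cx]; apply: contrapT => nCy; apply: nsep; exists C.
have Qclosed : closed Q by apply: closed_bigI => C [[]].
have Qconn : connected Q.
  move=> B [b Bb] [O oO BO] [D cD BD]; apply/seteqP; split=> [z|z Qz].
    by rewrite BO => -[].
  apply: contrapT => nBz.
  have Bclosed : closed B by rewrite BD; exact: closedI.
  have [V sV clV] : filter_from (set_nbhs B) closure (~` (Q `&` ~` O)).
    apply: compact_normal => //; apply/set_nbhsP; exists (~` (Q `&` ~` O)).
    split=> //; last by rewrite BO => w [Qw Ow] [].
    by apply: closed_openC; apply: closedI => //; exact: open_closedC.
  have /set_nbhsP[W [oW BW WV]] := sV.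
  have [C [[oC cC] Cx CW]] : exists C, [/\ clopen C, C x &
      forall w, C w -> setT w -> W w \/ ~ closure V w].
    apply: (compact_ind (P := fun U => exists C, [/\ clopen C, C x &
      forall w, C w -> U w -> W w \/ ~ closure V w]) cX).
    - by exists setT; split=> //; exact: clopenT.
    - move=> U1 U2 [C1 [cC1 C1x C1U]] [C2 [cC2 C2x C2U]]; exists (C1 `&` C2).
      split=> //; first exact: clopenI.
      by move=> w [C1w C2w] [/C1U|/C2U]; exact.
    - move=> w; have [Qw|/existsNP[C /not_implyP[[cC Cx] nCw]]] :=
        pselect (Q w); last first.
        exists (~` C); last by exists C; split.
        by apply: open_nbhs_nbhs; split=> //; apply: closed_openC; case: cC.
      have [Bw|nBw] := pselect (B w).
        exists W; last by exists setT; split=> //; [exact: clopenT|left].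
        by apply: open_nbhs_nbhs; split=> //; exact: BW.
      exists (~` closure V); last first.
        by exists setT; split=> //; [exact: clopenT|right].
      apply: open_nbhs_nbhs; split; first exact/closed_openC/closed_closure.
      by move=> /clV; apply; split=> // Ow; apply: nBw; rewrite BO.
  have CWE : C `&` W = C `&` closure V.
    apply/seteqP; split=> w [Cw Ww]; split=> //.
      exact/subset_closure/WV.
    by case: (CW w Cw I).
  have cCW : clopen (C `&` W).
    split; first exact: openI.
    by rewrite CWE; apply: closedI => //; exact: closed_closure.
  have [Wx|nWx] := pselect (W x).
    have := Qz _ (conj cCW (conj Cx Wx)); rewrite CWE => -[_ /clV]; apply.
    by split=> // Oz; apply: nBz; rewrite BO.
  have Qb : Q b by move: Bb; rewrite BO => -[].
  have := Qb _ (conj (clopenI (conj oC cC) (clopenC setT cCW)) _).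
  by move=> []; [split=> // -[]|move=> Cb; apply; split=> //; exact: BW].
have : connected_component [set: X] x y.
  by apply: (connected_component_max Qx _ Qconn).
by rewrite tX// => yx; move: xy; rewrite yx eqxx.
Qed.

Lemma boolean_clopen_nbhs (X : topologicalType) (x : X) (U : set X) :
  boolean_space X -> nbhs x U -> exists C, [/\ clopen C, C x & C `<=` U].
Proof.
move=> bX xU; have [hX cX _] := bX.
have [C [Cx cC] CU] :=
  zero_dimensional_cvg hX (boolean_zero_dimensional bX) cX xU.
by exists C.
Qed.
(** * Cantor-Bendixson derivatives *)

(** Shrinking the ambient set can only create isolated points; hence the
    derivative is monotone, which gives [cb_derivative_antitone] at successors. *)
Lemma isolatedS_anti (X : topologicalType) (A B : set X) (x : X) :
  A `<=` B -> A x -> isolated B x -> isolated A x.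
Proof.
move=> AB Ax [_ [V xV VB]]; split; first exact: mem_set.
exists V => //; apply/seteqP; split=> [y [Vy Ay]|_ ->]; last first.
  by split=> //; exact: nbhs_singleton.
by rewrite -VB; split=> //; exact: AB.
Qed.

Lemma cb_derivative_succ_sub (X : topologicalType) b :
  cb_derivative X (OSucc b) `<=` cb_derivative X b.
Proof. by move=> x []. Qed.

Lemma cb_derivative_closed (X : topologicalType) b :
  closed (cb_derivative X b).
Proof.
elim: b => [|b IH|I i0 f IH] /=; first exact: closedT.
  move=> x clx; have Ax : cb_derivative X b x.
    by apply: IH => V /clx[y [[]]]; exists y.
  split=> // -[_ [V xV VA]].
  have [y [[Ay niy] Vy]] := clx _ xV.
  have yx : y = x by have : (V `&` cb_derivative X b) y by []; rewrite VA.
  by apply: niy; rewrite yx; split; [exact: mem_set|exists V].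
by apply: closed_bigI => i _; exact: IH.
Qed.

Lemma cb_derivative_antitone (X : topologicalType) :
  (forall b c, b <=o c -> cb_derivative X c `<=` cb_derivative X b) /\
  (forall b c, b <o c -> cb_derivative X c `<=` cb_derivative X (OSucc b)).
Proof.
apply: ord_mut_ind => [//|//|I i0 f b _ IH x bx i _|b c _ IH x|b I i0 f i _ IH].
- exact: IH.
- by move=> [cx ni]; split; [exact: IH|move/(isolatedS_anti IH cx)].
- by move=> x fx; apply: IH; exact: fx.
Qed.

Section CBRank.
Variables (X : topologicalType) (a : Ord).
Hypothesis X_rank : has_cb_rank X a.

Lemma cb_rank_succ : cb_derivative X (OSucc a) = set0.
Proof.
have [_ ub _] := X_rank; apply: contrapT => /eqP/set0P/ub/ord_le_view.
by move/ord_le_lt_asym: (ord_le_refl a).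
Qed.

(** An empty [b]-th derivative would make [b] an upper bound of the ordinals
    whose derivative is nonempty, and the rank is the least of these. *)
Lemma cb_below_rank b : b <o a -> cb_derivative X b !=set0.
Proof.
have [_ _ lub] := X_rank => ba; apply: contrapT => b0.
suff /ord_le_lt_asym : a <=o b by apply.
apply: lub => c [x cx]; have [//|bc] := ord_le_or_gt c b.
case: b0; exists x; apply: cb_derivative_succ_sub.
by have [_ lt_anti] := cb_derivative_antitone X; exact: lt_anti cx.
Qed.

(** If the derivatives stopped decreasing at [b] before the rank [a], they
    would be constant from [b] on, whereas the one after [a] is empty. *)
Lemma cb_strict_below_rank b : b <o a ->
  exists x, cb_derivative X b x /\ ~ cb_derivative X a x.
Proof.
move=> ba; apply: contrapT => nex.
have stab c : cb_derivative X b `<=` cb_derivative X c.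
  elim: c => [//|c IH|I i0 f IH] x bx; last by move=> i _; exact: IH.
  split; [exact: IH|move/(isolatedS_anti IH bx)].
  have [_ lt_anti] := cb_derivative_antitone X.
  have ax : cb_derivative X a x.
    by apply: contrapT => nax; apply: nex; exists x.
  by have [] := lt_anti _ _ ba _ ax.
by have [x /(stab (OSucc a))] := cb_below_rank ba; rewrite cb_rank_succ.
Qed.

End CBRank.

(** * Collapsing two-element intervals *)

Lemma small_intervalP (d : Order.disp_t) (L : latticeType d) (x y : L) :
  small_interval x y <->
  x <= y /\ forall z, x <= z <= y -> z = x \/ z = y.
Proof.
split=> -[xy card2]; split=> //; last first.
  pose f z := if z == x then 0%N else 1%N.
  apply/pcard_leP/injfunPex; exists f; first by rewrite /f => z _ /=; case: ifP.
  move=> z w /set_mem/card2 zE /set_mem/card2 wE; rewrite /f.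
  by case: eqP => [->|nzx]; case: eqP => [->|nwx] // _; case: zE; case: wE;
    congruence.
move=> z xzy; have /pcard_leP/injfunPex[f f2 finj] := card2.
have fP u v : x <= u <= y -> x <= v <= y -> f u = f v -> u = v.
  by move=> xu xv; apply: finj; exact: mem_set.
have xx : x <= x <= y by rewrite lexx.
have yy : x <= y <= y by rewrite lexx andbT.
have [exy|nxy] := eqVneq x y; first by left; apply: le_anti; rewrite {1}exy andbC.
have {nxy} nfxy : f x <> f y by move=> /(fP _ _ xx yy)/eqP; exact/negP.
suff [/(fP _ _ xzy xx)|/(fP _ _ xzy yy)] : f z = f x \/ f z = f y by [left|right].
have := f2 _ xx; have := f2 _ yy; have := f2 _ xzy; move: nfxy => /=.
case: (f x) (f y) (f z) => [|[|?]] [|[|?]] [|[|?]] // *; by [left | right].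
Qed.

Section SuccessorKernel.
Context {d : Order.disp_t} {L : tbLatticeType d}.
Implicit Types (b : Ord) (u v w : L).

(** The two-element intervals of a quotient, expressed on representatives: this
    is what allows the kernels to be computed inside [L]. *)
Definition mdim_adjacent b u v : Prop :=
  u <= v /\ forall w, u <= w <= v -> mdim_kernel b w u \/ mdim_kernel b w v.

(** An element of the quotient between the classes of [u] and [v] has a
    representative between [u] and [v]: clamp any of its representatives. *)
Lemma mdim_adjacentP b u v : u <= v ->
  mdim_adjacent b u v <->
  small_interval (quotient_map (mdim_quot L b) u)
                 (quotient_map (mdim_quot L b) v).
Proof.
move=> uv; have [bS bI bU] := mdim_quotP L b.
have mono w w' : w <= w' ->
    quotient_map (mdim_quot L b) w <= quotient_map (mdim_quot L b) w'.
  by move=> /meet_idPl ww'; apply/meet_idPl; rewrite -bI ww'.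
split=> [[_ adj]|/small_intervalP[_ small]]; last first.
  by split=> // w /andP[uw wv]; apply: small; rewrite !mono.
apply/small_intervalP; split=> [|q]; first exact: mono.
have [w <-] := bS q => /andP[uw wv].
have clamp : u <= ((w `|` u) `&` v)%O <= v by rewrite leIr lexI uv leUr.
have -> : quotient_map (mdim_quot L b) w =
          quotient_map (mdim_quot L b) ((w `|` u) `&` v)%O.
  by rewrite bI bU (join_l uw) (meet_l wv).
exact: adj clamp.
Qed.

Lemma mdim_kernel_succ_of b u v :
  mdim_kernel b u v -> mdim_kernel (OSucc b) u v.
Proof. by move=> uv; congr (lq_pi _ _). Qed.

Lemma mdim_adjacent_kernel_succ b u v :
  mdim_adjacent b u v -> mdim_kernel (OSucc b) u v.
Proof.
move=> adj; have [uv _] := adj.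
by apply/lq_piE; apply: sub_generated_congruence; apply/mdim_adjacentP.
Qed.

(** Together with [mdim_kernel_succ_of] and [mdim_adjacent_kernel_succ], this
    describes [mdim_kernel (OSucc b)] without quotients: it is the smallest
    congruence on [L] that contains [mdim_kernel b] and the adjacent pairs. *)
Lemma mdim_kernel_succ_min b (t : L -> L -> Prop) : congruence t ->
    (forall u v, mdim_kernel b u v -> t u v) ->
    (forall u v, mdim_adjacent b u v -> t u v) ->
  forall u v, mdim_kernel (OSucc b) u v -> t u v.
Proof.
move=> [tR tC tT tI tU] bt adjt u v /lq_piE uv.
have [bS bI bU] := mdim_quotP L b.
pose pb := quotient_map (mdim_quot L b).
(* [t] seen as a relation on the quotient *)
pose s p q := exists x y, [/\ pb x = p, pb y = q & t x y].
have sE x y : s (pb x) (pb y) -> t x y.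
  move=> [x' [y' [xx' yy' xy']]]; apply: tT (tT _ _ _ _ xy') _.
    by apply: bt; rewrite /mdim_kernel -/pb xx'.
  by apply: bt; rewrite /mdim_kernel -/pb yy'.
have Es x y : t x y -> s (pb x) (pb y) by exists x, y.
apply: (sE); apply: uv => [|p q].
  split=> [p|p q|p q r|p p' q q'|p p' q q'].
  - by have [x <-] := bS p; exact: Es.
  - by move=> [x [y [<- <-]]] /tC; exact: Es.
  - have [z <-] := bS r; move=> [x [y [<- <-]]] xy /sE yz.
    by apply: Es; exact: tT yz.
  - move=> [x [x' [<- <-]]] xx [y [y' [<- <-]]] yy.
    by rewrite /pb -!bI; apply: Es; exact: tI.
  - move=> [x [x' [<- <-]]] xx [y [y' [<- <-]]] yy.
    by rewrite /pb -!bU; apply: Es; exact: tU.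
have [x <-] := bS p; have [y <-] := bS q => small.
(* The representatives need not be comparable, but [x `&` y] represents [p]. *)
have xyE : pb (x `&` y)%O = pb x.
  by rewrite /pb bI; apply/meet_idPl; case: small.
rewrite -/pb -xyE; apply: Es; apply: adjt.
by apply/mdim_adjacentP; rewrite ?leIr// -/pb xyE.
Qed.

End SuccessorKernel.
(** * Functions on a Boolean space *)

Section Functions.
Variables (X : topologicalType) (a : Ord).
Implicit Types (f g h k : Cminus_pos X a) (x y : X) (U : set X).

Lemma Cminus_pos_near f x : \forall y \near x, f y = f x.
Proof. by have /is_CminusP[+ _] := Cminus_funP f; exact. Qed.

Lemma Cminus_pos_vanish f x : cb_derivative X a x -> f x = 0%R.
Proof. by have /is_CminusP[_] := Cminus_funP f; exact. Qed.

Lemma Cminus_pos_ext f g : f =1 g -> f = g.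
Proof. by move=> fg; do 2!apply: val_inj; exact/funext. Qed.

Lemma Cminus_pos_leP f g : reflect (forall x, f x <= g x) (f <= g).
Proof. exact: lefP. Qed.

Lemma Cminus_pos_ge0 f x : 0%R <= f x.
Proof. by have /lefP := Cminus_pos_funP f; exact. Qed.

(** Nearly all functions below are obtained by changing a given one on a clopen
    set.  The new values [g] need the sign and vanishing conditions on that set
    only, so [g] can be a constant or [f + 1]. *)
Lemma Cminus_pos_patch f (g : X -> int) U : clopen U ->
    (forall x, \forall y \near x, g y = g x) ->
    (forall x, U x -> 0%R <= g x) ->
    (forall x, U x -> cb_derivative X a x -> g x = 0%R) ->
  exists k : Cminus_pos X a,
    (forall x, U x -> k x = g x) /\ (forall x, ~ U x -> k x = f x).
Proof.
move=> [oU cU] gloc g0 ga; pose h := patch f U g.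
have hU x : U x -> h x = g x by move=> Ux; rewrite /h patchT//; exact: mem_set.
have hnU x : ~ U x -> h x = f x.
  by move=> nUx; rewrite /h patchC//; exact: mem_set.
have hP : h \in is_Cminus a.
  apply/is_CminusP; split=> x; last first.
    have [Ux|nUx] := pselect (U x); first by rewrite hU//; exact: ga.
    by rewrite hnU//; exact: Cminus_pos_vanish.
  have [Ux|nUx] := pselect (U x).
    apply: filterS2 (open_nbhs_nbhs (conj oU Ux)) (gloc x) => y Uy gyx.
    by rewrite !hU.
  have oUC : open (~` U) by exact: closed_openC.
  apply: filterS2 (open_nbhs_nbhs (conj oUC nUx)) (Cminus_pos_near f x).
  by move=> y nUy fyx; rewrite !hnU.
have hpos : MkCminus hP \in @is_pos X a.
  apply/lefP => x; change (0%R <= h x); have [Ux|nUx] := pselect (U x).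
    by rewrite hU// g0.
  by rewrite hnU// Cminus_pos_ge0.
by exists (MkCminus_pos hpos).
Qed.

(** Agreement of two elements of the lattice on a set of points; the top
    element agrees with no function, not even on the empty set. *)
Definition agree (A : set X) (u v : Cminus_pos_infty X a) : Prop :=
  match u, v with
  | Some f, Some g => forall x, A x -> f x = g x
  | None, None => True
  | _, _ => False
  end.

Lemma agree_congruence A : congruence (agree A).
Proof.
split.
- by case.
- by move=> [f|] [g|] //= fg x Ax; rewrite fg.
- by move=> [f|] [g|] [h|] //= fg gh x Ax; rewrite fg ?gh.
- move=> [f|] [f'|] [g|] [g'|] //= ff gg x Ax.
  change (f x `&` g x = f' x `&` g' x)%O.
  by rewrite ff ?gg.
- move=> [f|] [f'|] [g|] [g'|] //= ff gg x Ax.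
  change (f x `|` g x = f' x `|` g' x)%O.
  by rewrite ff ?gg.
Qed.

Lemma agree_sub (A B : set X) u v : A `<=` B -> agree B u v -> agree A u v.
Proof. by move=> AB; case: u v => [f|] [g|] //= fg x /AB; exact: fg. Qed.

End Functions.
(** * The kernels of the iterated quotients *)

Section Kernels.
Variables (X : topologicalType) (a : Ord).
Hypotheses (X_boolean : boolean_space X) (X_rank : has_cb_rank X a).

Notation "X ^( b )" := (cb_derivative X b) (at level 2, format "X ^( b )").
Notation L := (Cminus_pos_infty X a).

Lemma clopen_nbhs_avoiding b (x : X) : ~ X^(b) x ->
  exists U, [/\ clopen U, U x & U `&` X^(b) = set0].
Proof.
move=> nbx; have /(boolean_clopen_nbhs X_boolean)[U [cU Ux UC]] :
    nbhs x (~` X^(b)).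
  apply: open_nbhs_nbhs; split=> //.
  exact/closed_openC/cb_derivative_closed.
by exists U; split=> //; apply/disjoints_subset.
Qed.

Lemma clopen_nbhs_isolating b (x : X) : isolated X^(b) x ->
  exists U, [/\ clopen U, U x & forall y, U y -> X^(b) y -> y = x].
Proof.
move=> [_ [V /(boolean_clopen_nbhs X_boolean)[U [cU Ux UV]] Vx]].
exists U; split=> // y Uy bx; suff : [set x] y by [].
by rewrite -Vx; split=> //; exact: UV.
Qed.

(** A point of [X^(OSucc b)] where the two functions differ is a limit of points
    of [X^(b)], so one can jump from the smaller to the larger near it while
    keeping the smaller at another point of [X^(b)]: this gives a third class
    in between.  Below the top element, [f + 1] on a small clopen set plays the
    same part. *)
Lemma adjacent_agree b (u v : L) : b <o a ->
    (forall u v : L, mdim_kernel b u v -> agree X^(b) u v) ->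
  mdim_adjacent b u v -> agree X^(OSucc b) u v.
Proof.
move=> ba sub [uv adj]; case: u v uv adj => [f|] [g|] //= uv adj.
  move=> x [bx nisox]; apply: contrapT => fgx.
  (* On [V] both functions keep their values at [x], so they still differ at the
     second point [y]. *)
  pose V := [set y | f y = f x /\ g y = g x].
  have xV : nbhs x V by apply: filterI; exact: Cminus_pos_near.
  have [y [by_ Vy yx]] : exists y, [/\ X^(b) y, V y & y <> x].
    apply: contrapT => nex; apply: nisox; split; first exact: mem_set.
    exists V => //; apply/seteqP; split=> [y [Vy by_]|_ ->]; last first.
      by split=> //; exact: nbhs_singleton.
    by apply: contrapT => yx; apply: nex; exists y.
  have [U [cU Ux nUy]] : exists U, [/\ clopen U, U x & ~ U y].
    apply: (boolean_zero_dimensional X_boolean).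
    by apply/eqP => xy; exact: yx.
  have [k [kU knU]] := Cminus_pos_patch f cU (Cminus_pos_near g)
    (fun z _ => Cminus_pos_ge0 g z) (fun z _ => @Cminus_pos_vanish _ _ g z).
  have fg z : f z <= g z by move: uv => /Cminus_pos_leP.
  have fkg : (Some f : L) <= (Some k : L) <= (Some g : L).
    apply/andP; split; apply/Cminus_pos_leP => z;
      by have [Uz|nUz] := pselect (U z); [rewrite kU|rewrite knU].
  have [/sub/(_ x bx)|/sub/(_ y by_)] := adj _ fkg.
    by rewrite kU// => /esym.
  by rewrite knU//; case: Vy => -> ->.
have [x [bx nax]] := cb_strict_below_rank X_rank ba.
have [U [cU Ux Ua]] := clopen_nbhs_avoiding nax.
have [k [kU knU]] : exists k : Cminus_pos X a,
    (forall z, U z -> k z = (f z + 1)%R) /\ (forall z, ~ U z -> k z = f z).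
  apply: Cminus_pos_patch => // [z|z Uz|z Uz az].
  - by apply: filterS (Cminus_pos_near f z) => y ->.
  - by rewrite addr_ge0// Cminus_pos_ge0.
  - by have : (U `&` X^(a)) z by []; rewrite Ua.
have fk : (Some f : L) <= (Some k : L) <= (None : L).
  rewrite lex1 andbT; apply/Cminus_pos_leP => z.
  by have [Uz|nUz] := pselect (U z); [rewrite kU// lerDl|rewrite knU].
have [/sub/(_ x bx)|/sub//] := adj _ fk.
by rewrite kU// => /eqP; rewrite addrC -subr_eq0 addrK oner_eq0.
Qed.

(** Functions that differ on [X^(b)] only at an isolated point [x] are joined by
    increasing the value at [x] by one repeatedly; no integer fits between two
    consecutive values, so each step is a two-element interval modulo
    [mdim_kernel b].  As [b] is below the rank, [x] lies outside [X^(a)] and the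
    intermediate functions may be nonzero there. *)
Lemma isolated_kernel_succ b x (f g : Cminus_pos X a) : b <o a ->
    (forall u v : L, agree X^(b) u v -> mdim_kernel b u v) ->
    isolated X^(b) x ->
    (forall y, X^(b) y -> y <> x -> f y = g y) ->
  mdim_kernel (OSucc b) (Some f : L) (Some g : L).
Proof.
move=> ba sub isox.
have [kR kC kT _ _] := mdim_kernel_congruence L (OSucc b).
have nax : ~ X^(a) x.
  have [_ lt_anti] := cb_derivative_antitone X.
  by move=> /(lt_anti _ _ ba)[].
have [U [cU Ux Ub]] := clopen_nbhs_isolating isox.
have [U' [cU' U'x U'a]] := clopen_nbhs_avoiding nax.
wlog fgx : f g / f x <= g x => [th|].
  have [fgx|gfx] := leP (f x) (g x); first exact: th.
  move=> fg; apply: kC; apply: th => //; first exact: ltW.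
  by move=> y bY yx; rewrite fg.
have [n fgn] : exists n : nat, g x = (f x + n%:Z)%R.
  have : 0%R <= (g x - f x)%R by rewrite subr_ge0.
  by move=> /gez0_abs fgE; exists `|g x - f x|%N; rewrite fgE addrC subrK.
elim: n g fgn {fgx} => [|n IH] g fgn fg.
  apply: mdim_kernel_succ_of; apply: sub => y bY.
  by have [->|/eqP yx] := eqVneq y x; [rewrite fgn addr0|exact: fg].
(* The last step goes from [k], which lags one behind [g] at [x], up to [g]. *)
have [k [kU knU]] : exists k : Cminus_pos X a,
    (forall z, (U `&` U') z -> k z = (f x + n%:Z)%R) /\
    (forall z, ~ (U `&` U') z -> k z = g z).
  apply: (Cminus_pos_patch g (g := fun=> (f x + n%:Z)%R)).
  - exact: clopenI.
  - by move=> z; exact: nearW.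
  - by move=> z _; rewrite addr_ge0 ?Cminus_pos_ge0.
  - by move=> z [_ U'z] az; have : (U' `&` X^(a)) z by []; rewrite U'a.
have kx : k x = (f x + n%:Z)%R by rewrite kU.
have kg y : X^(b) y -> y <> x -> k y = g y.
  by move=> bY yx; rewrite knU// => -[Uy _]; apply: yx; exact: Ub.
have fk : mdim_kernel (OSucc b) (Some f : L) (Some k : L).
  by apply: IH => // y bY yx; rewrite kg// fg.
apply: (kT _ _ _ fk) => {fk}.
have gx1 : g x = (k x + 1)%R by rewrite kx fgn intS addrCA addrC.
(* Outside [X^(b)] the function [k] need not be below [g]; meeting it with [g]
   makes the two comparable without leaving the class of [k]. *)
apply: (kT _ (Some (k `&` g)%O : L)).
  apply: mdim_kernel_succ_of; apply: sub => y bY.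
  change (k y = (k y `&` g y)%O); apply/esym/meet_idPl.
  by have [->|/eqP yx] := eqVneq y x; [rewrite gx1 lerDl|rewrite kg].
apply: mdim_adjacent_kernel_succ; split; first exact: (leIr g k).
case=> [h|/andP[_ //]] /andP[/Cminus_pos_leP kh /Cminus_pos_leP hg].
have kE y : (k `&` g)%O y = (k y `&` g y)%O by [].
have hy y : X^(b) y -> y <> x -> h y = g y.
  move=> bY yx; apply/le_anti; rewrite hg /=.
  by apply: le_trans (kh y); rewrite kE kg// meetxx.
have kgx : (k x `&` g x)%O = k x by apply/meet_idPl; rewrite gx1 lerDl.
have [hxg|hxg] := eqVneq (h x) (g x).
  right; apply: sub => y bY.
  by have [->|/eqP yx] := eqVneq y x; [|exact: hy].
left; apply: sub => y bY; change (h y = (k y `&` g y)%O).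
have [->|/eqP yx] := eqVneq y x; last by rewrite hy// kg// meetxx.
rewrite kgx; apply/le_anti; rewrite -[in X in _ && X]kgx -kE kh andbT.
have : h x < g x by rewrite lt_neqAle hxg hg.
by rewrite gx1 ltzD1.
Qed.

(** Changing a function from [f] to [g] on a clopen set [U] stays in one class of
    the next kernel; this property of [U] holds locally and passes to unions,
    hence holds for the whole space.  The functions involved take at each point
    the value of [f] or that of [g], so that a neighbourhood on which [f = g]
    works for all of them. *)
Lemma agree_kernel_succ b : b <o a ->
    (forall u v : L, agree X^(b) u v -> mdim_kernel b u v) ->
  forall u v : L, agree X^(OSucc b) u v -> mdim_kernel (OSucc b) u v.
Proof.
move=> ba sub [f|] [g|] //= fg.
have [kR kC kT _ _] := mdim_kernel_congruence L (OSucc b).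
pose spliced h := forall x : X, h x = f x \/ h x = g x.
pose P U := clopen U /\ forall h k : Cminus_pos X a, spliced h -> spliced k ->
  (forall x, ~ U x -> h x = k x) ->
  mdim_kernel (OSucc b) (Some h : L) (Some k : L).
have [_ cX _] := X_boolean.
suff [_ PT] : P setT by apply: PT; [move=> x; left|move=> x; right|move=> x []].
apply: (compact_ind (P := P) cX).
- split=> [|h k _ _ hk]; first exact: clopen0.
  by rewrite (Cminus_pos_ext (f := h) (g := k))// => x; exact: hk.
- move=> U V [cU PU] [cV PV]; split=> [|h k bh bk hk]; first exact: clopenU.
  have [m [mU mnU]] := Cminus_pos_patch h cU (Cminus_pos_near k)
    (fun z _ => Cminus_pos_ge0 k z) (fun z _ => @Cminus_pos_vanish _ _ k z).
  have bm : spliced m.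
    by move=> x; have [Ux|nUx] := pselect (U x); [rewrite mU|rewrite mnU].
  have hm := PU h m bh bm (fun x nUx => esym (mnU x nUx)).
  apply: (kT _ _ _ hm); apply: PV => // x nVx.
  by have [/mU//|nUx] := pselect (U x); rewrite mnU// hk// => -[].
- move=> x; have [bx|nbx] := pselect (X^(b) x); last first.
    have [U [cU Ux Ub]] := clopen_nbhs_avoiding nbx; exists U.
      by apply: open_nbhs_nbhs; split=> //; case: cU.
    split=> // h k _ _ hk; apply: mdim_kernel_succ_of; apply: sub => y bY.
    by apply: hk => Uy; have : (U `&` X^(b)) y by []; rewrite Ub.
  have [isox|nisox] := pselect (isolated X^(b) x).
    have [U [cU Ux Ub]] := clopen_nbhs_isolating isox; exists U.
      by apply: open_nbhs_nbhs; split=> //; case: cU.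
    split=> // h k _ _ hk; apply: (isolated_kernel_succ ba sub isox).
    by move=> y bY yx; apply: hk => Uy; apply: yx; exact: Ub.
  have fgx := fg x (conj bx nisox).
  have : nbhs x [set y | f y = g y].
    apply: filterS2 (Cminus_pos_near f x) (Cminus_pos_near g x).
    by move=> y /= -> ->.
  move=> /(boolean_clopen_nbhs X_boolean)[U [cU Ux UV]]; exists U.
    by apply: open_nbhs_nbhs; split=> //; case: cU.
  split=> // h k bh bk hk.
  rewrite (Cminus_pos_ext (f := h) (g := k))// => y.
  have [Uy|] := pselect (U y); last exact: hk.
  by have /= fgy := UV y Uy; case: (bh y) (bk y) => -> [] ->.
Qed.

(** The set where two functions differ is compact, and so cannot meet all members
    of a decreasing family of closed sets without meeting the intersection. *)
Lemma agree_sup I i0 (f : I -> Ord) (u v : L) :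
  agree X^(OSup i0 f) u v -> exists i, agree X^(f i) u v.
Proof.
case: u v => [g|] [h|] //= gh.
have [_ cX _] := X_boolean.
have [le_anti _] := cb_derivative_antitone X.
pose P U := exists i, forall x, U x -> X^(f i) x -> g x = h x.
suff [i Pi] : P setT by exists i => x; exact: Pi.
apply: (compact_ind (P := P) cX); first by exists i0.
- have PU U V i j : f i <=o f j ->
      (forall x, U x -> X^(f i) x -> g x = h x) ->
      (forall x, V x -> X^(f j) x -> g x = h x) -> P (U `|` V).
    by move=> ij PU PV; exists j => x [/PU gh' /(le_anti _ _ ij)/gh'|/PV].
  move=> U V [i Pi] [j Pj]; have [ij|/ord_ltW ji] := ord_le_or_gt (f i) (f j).
    exact: PU Pi Pj.
  by rewrite setUC; exact: PU Pj Pi.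
- move=> x.
  have [supx|/existsNP[i /not_implyP[_ nix]]] := pselect (X^(OSup i0 f) x).
    exists [set y | g y = h y]; last by exists i0.
    apply: filterS2 (Cminus_pos_near g x) (Cminus_pos_near h x).
    by move=> y /= -> ->; exact: gh.
  have [U [cU Ux Ui]] := clopen_nbhs_avoiding nix; exists U.
    by apply: open_nbhs_nbhs; split=> //; case: cU.
  by exists i => y Uy iy; have : (U `&` X^(f i)) y by []; rewrite Ui.
Qed.

Lemma mdim_kernelE b (u v : L) : b <=o a ->
  mdim_kernel b u v <-> agree X^(b) u v.
Proof.
move=> ba; elim: b ba u v => [|b IH|I i0 f IH] /ord_le_view ba u v.
- split=> [->|]; first by have [+ _ _ _ _] := @agree_congruence X a X^(OZero).
  case: u v => [f|] [g|] //= fg; congr Some; apply: Cminus_pos_ext => x.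
  exact: fg.
- have {}IH := IH (ord_ltW ba); split; last first.
    by apply: agree_kernel_succ => // w w' /IH.
  apply: mdim_kernel_succ_min; first exact: agree_congruence.
    by move=> w w' /IH; apply: agree_sub; exact: cb_derivative_succ_sub.
  by move=> w w'; apply: adjacent_agree => // z z' /IH.
- split=> [/mdim_kernel_sup[i /(IH i (ba i))]|].
    by apply: agree_sub => x; exact.
  move=> /(agree_sup (i0 := i0))[i fi]; apply/mdim_kernel_sup.
  by exists i; apply/IH.
Qed.

End Kernels.

Theorem lemma8p12 (X : topologicalType) (a : Ord)
    (X_boolean : boolean_space X) (X_rank : has_cb_rank X a) :
  has_mdim (Cminus_pos_infty X a) a.
Proof.
pose L := Cminus_pos_infty X a.
have [kR kC kT _ _] := mdim_kernel_congruence L (OSucc a).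
have kernelE := mdim_kernelE X_boolean X_rank.
split.
- by exists (\bot : L), (\top : L).
- suff top (u : L) : mdim_kernel (OSucc a) u None.
    move=> p q; have [aS _ _] := mdim_quotP L (OSucc a).
    have [[u <-] [v <-]] := (aS p, aS q).
    exact: kT (top u) (kC _ _ (top v)).
  case: u => [g|]; last exact: kR.
  apply: mdim_adjacent_kernel_succ; split; first exact: lex1.
  case=> [f|] _; [left|right=> //]; apply/kernelE; first exact: ord_le_refl.
  by move=> x ax; rewrite !Cminus_pos_vanish.
- move=> b trivb; have [//|/ord_lt_view ba] := ord_le_or_gt (OSucc a) b.
  have : mdim_kernel b (\bot : L) (\top : L) by exact: trivb.
  by move=> /(kernelE _ _ _ ba).
Qed.
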